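(* The out-of-order membership problem for the language $\Sigma^*aa\Sigma^*$ on the alphabet $\Sigma=\{a,b\}$ requires linear space, i.e., it has $\Omega(n)$ space complexity.
   Context: Problem. Let $w=w[1]\cdots w[n]$ be a word of length $n>0$ over $\Sigma$ and let $\pi$ be a permutation of $\{1,\ldots,n\}$. The out-of-order stream of $w$ defined by $\pi$ is the sequence of triples $(w[\pi(i)],\pi(i),n)$ for $i=1,\ldots,n$. In the out-of-order membership problem for a fixed language $L\subseteq\Sigma^*$, the algorithm receives the triples one after the other, for arbitrary $w$ and arbitrary $\pi$, and must decide at the end whether $w\in L$. The length $n$ is known and not counted in the space. Space. Algorithms are deterministic, and only the bits memorized between two consecutive stream elements are counted (computation time and interim memory used while processing an element are ignored). Formally, an algorithm using $s(n)$ bits consists, for each $n\ge 1$, of a set $Q_n$ of memory states with $|Q_n|\le 2^{s(n)}$, an initial state, an update function $Q_n\times\Sigma\times\{1,\ldots,n\}\to Q_n$, and an output function $Q_n\to\{\text{yes},\text{no}\}$, such that for every $w\in\Sigma^n$ and every permutation $\pi$ the output after processing the stream is correct. The problem has $\Omega(g(n))$ space complexity if every algorithm uses $s(n)=\Omega(g(n))$ bits, where $s=\Omega(g)$ means $\limsup_{n\to\infty}s(n)/g(n)>0$ (Hardy--Littlewood convention). *)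

(* Defs.v *)
From HB Require Import structures.
From mathcomp Require Import all_boot all_order all_algebra all_fingroup.
From mathcomp Require Import all_classical all_reals all_analysis.

Set Implicit Arguments.
Unset Strict Implicit.
Unset Printing Implicit Defensive.

Import Order.TTheory GRing.Theory Num.Theory.
Local Open Scope classical_set_scope.
Local Open Scope ring_scope.

(** Words of length [n] are [n.-tuple Sigma]; the positions {1, ..., n} are
    represented by ['I_n], i.e. shifted to {0, ..., n-1}. *)

Definition out_of_order_stream (Sigma : finType) (n : nat)
    (w : n.-tuple Sigma) (pi : {perm 'I_n}) : seq (Sigma * 'I_n * nat) :=
  [seq (tnth w (pi i), pi i, n) | i <- enum 'I_n].

(** The part of an algorithm that handles the inputs of length [n].  The update
    ignores the third component of the triples: it is always [n], which is
    known to the algorithm through the type. *)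
Record device (Sigma : finType) (n : nat) := Device {
  state : finType;
  init : state;
  update : state -> Sigma -> 'I_n -> state;
  output : state -> bool
}.

Definition run (Sigma : finType) (n : nat) (D : device Sigma n)
    (st : seq (Sigma * 'I_n * nat)) : state D :=
  foldl (fun q x => update q x.1.1 x.1.2) (init D) st.

(** The device for [n = 0] is a dummy: nothing is required of it below. *)
Definition algorithm (Sigma : finType) := forall n : nat, device Sigma n.

Definition solves_out_of_order (Sigma : finType) (L : set (seq Sigma))
    (A : algorithm Sigma) : Prop :=
  forall (n : nat) (w : n.-tuple Sigma) (pi : {perm 'I_n}), (0 < n)%N ->
    output (run (A n) (out_of_order_stream w pi)) <-> L w.

Definition uses_bits (R : realType) (Sigma : finType) (A : algorithm Sigma)
    (s : nat -> R) : Prop :=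
  forall n : nat, (0 < n)%N -> #|state (A n)|%:R <= 2 `^ s n.

(** Hardy--Littlewood convention: a limit superior, so [s] has to be large for
    infinitely many [n] only. *)
Definition is_Omega (R : realType) (s g : nat -> R) : Prop :=
  (0 < limn_esup (fun n => (s n / g n)%:E))%E.

Definition out_of_order_space_Omega (R : realType) (Sigma : finType)
    (L : set (seq Sigma)) (g : nat -> R) : Prop :=
  forall (A : algorithm Sigma) (s : nat -> R),
    solves_out_of_order L A -> uses_bits A s -> is_Omega s g.

Inductive letter := a | b.

Definition bool_of_letter (x : letter) : bool := if x is a then true else false.
Definition letter_of_bool (c : bool) : letter := if c then a else b.

Lemma bool_of_letterK : cancel bool_of_letter letter_of_bool.
Proof. by case. Qed.

HB.instance Definition _ := Finite.copy letter (can_type bool_of_letterK).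

Definition Sigma_aa_Sigma : set (seq letter) :=
  [set w | exists u v : seq letter, w = u ++ [:: a; a] ++ v].

(* Main.v *)
Require Import Defs.
From mathcomp Require Import all_boot all_algebra all_reals.
From mathcomp Require Import all_order all_fingroup all_classical all_analysis.
From mathcomp Require Import zify.

(** Cut the positions into blocks of length 3.  The stream first delivers the
    first letters of all blocks, which spell an arbitrary set [X] of blocks, and
    then the other letters: [b] everywhere except for one [a] in the middle of
    block [i].  Then [aa] occurs exactly if [i] is in [X], so the memory after the
    first part determines [X], and there are at least [2 ^ (n / 3)] states
    whenever 3 divides [n]. *)

Set Implicit Arguments.
Unset Strict Implicit.
Unset Printing Implicit Defensive.

Import Order.TTheory GRing.Theory Num.Theory.

Lemma run_cat (Sigma : finType) (n : nat) (D : device Sigma n)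
    (s t : seq (Sigma * 'I_n * nat)) :
  run D (s ++ t) = foldl (fun q x => update q x.1.1 x.1.2) (run D s) t.
Proof. exact: foldl_cat. Qed.

(** One [pi] serves all words at once, so that streams of different words can be compared in the
    same order of arrival. *)
Lemma out_of_order_stream_of_perm_eq (Sigma : finType) (n : nat)
    (s : seq 'I_n) : perm_eq s (enum 'I_n) ->
  exists pi : {perm 'I_n}, forall w : n.-tuple Sigma,
    out_of_order_stream w pi = [seq (tnth w p, p, n) | p <- s].
Proof.
move=> s_enum; have /tuple_permP[pi ->] : perm_eq s (ord_tuple n).
  by rewrite val_ord_tuple.
exists pi => w; rewrite /out_of_order_stream /= -map_comp.
by apply: eq_map => i /=; rewrite tnth_ord_tuple.
Qed.

(* One-way communication: the positions in [P] come first in the stream, so all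
   that the device remembers of [x] is its state at that moment. *)
Lemma card_state_ge (Sigma : finType) (n : nat) (D : device Sigma n)
    (L : set (seq Sigma)) (P : pred 'I_n) (X : finType) (Y : Type) (y0 : Y)
    (w : X -> Y -> n.-tuple Sigma) :
  (forall v pi, output (run D (out_of_order_stream v pi)) <-> L v) ->
  (forall x y y' p, P p -> tnth (w x y) p = tnth (w x y') p) ->
  (forall x x' y p, ~~ P p -> tnth (w x y) p = tnth (w x' y) p) ->
  (forall x x', (forall y, L (w x y) <-> L (w x' y)) -> x = x') ->
  #|X| <= #|state D|.
Proof.
move=> D_L w_l w_r w_sep.
pose part (Q : pred 'I_n) (v : n.-tuple Sigma) := [seq (tnth v p, p, n) | p <- enum 'I_n & Q p].
have [pi stream_pi] : exists pi : {perm 'I_n}, forall v : n.-tuple Sigma,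
    out_of_order_stream v pi = part P v ++ part (predC P) v.
  have [|pi Hpi] := @out_of_order_stream_of_perm_eq Sigma n
      ([seq p <- enum 'I_n | P p] ++ [seq p <- enum 'I_n | predC P p]).
    exact/permPl/perm_filterC.
  by exists pi => v; rewrite Hpi map_cat.
have part_eq (Q : pred 'I_n) u v :
    (forall p, Q p -> tnth u p = tnth v p) -> part Q u = part Q v.
  by move=> uv; apply/eq_in_map => p; rewrite mem_filter => /andP[/uv -> _].
(* The state after the first part is injective in [x]. Fixing [y0] is harmless, since the letters at
   positions in [P] do not depend on [y]. *)
apply: (@leq_card _ _ (fun x => run D (part P (w x y0)))) => x x' eq_run.
apply: w_sep => y; rewrite -!(D_L _ pi) !stream_pi !run_cat.
rewrite (part_eq P _ (w x y0)); last by move=> p /w_l; apply.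
rewrite (part_eq P (w x' y) (w x' y0)); last by move=> p /w_l; apply.
rewrite eq_run (part_eq (predC P) _ (w x' y)) // => p /=; exact: w_r.
Qed.

(** The default letter is [b], so an [a] read at [k.+1] already places that index inside [w]. *)
Lemma Sigma_aa_SigmaP (w : seq letter) :
  Sigma_aa_Sigma w <-> exists k, nth b w k = a /\ nth b w k.+1 = a.
Proof.
split=> [[u [v ->]]|[k [wk wk1]]].
  exists (size u); split; first by rewrite nth_cat ltnn subnn.
  by rewrite nth_cat ltnNge leqnSn /= subSnn.
have lt_k1 : k.+1 < size w.
  by rewrite ltnNge; apply/negP => le_w; move: wk1; rewrite nth_default.
exists (take k w), (drop k.+2 w).
rewrite -{1}(cat_take_drop k w) (drop_nth b); last exact: ltnW.
by rewrite (drop_nth b) // wk wk1.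
Qed.

(** For [k < 3 * m.+1] the quotient [k %/ 3] is a genuine block index, and [inord] merely retypes
    it. *)
Definition block_letter (m : nat) (X : {set 'I_m.+1}) (i : 'I_m.+1) (k : nat)
    : letter :=
  letter_of_bool (((k %% 3 == 0) && (inord (k %/ 3) \in X))
                  || ((k %% 3 == 1) && (k %/ 3 == i))).

Definition block_word (m : nat) (X : {set 'I_m.+1}) (i : 'I_m.+1)
    : (3 * m.+1).-tuple letter :=
  [tuple block_letter X i p | p < 3 * m.+1].

Lemma nth_block_word (m : nat) (X : {set 'I_m.+1}) (i : 'I_m.+1) (k : nat) :
  k < 3 * m.+1 -> nth b (block_word X i) k = block_letter X i k.
Proof. by move=> lt_k; rewrite -(tnth_nth b _ (Ordinal lt_k)) tnth_mktuple. Qed.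

Lemma letter_of_bool_a (c : bool) : letter_of_bool c = a <-> c.
Proof. by case: c. Qed.

(** The last letter of each block is [b], so [aa] cannot straddle two blocks or end one: it must
    fill the first two places of block [i]. *)
Lemma Sigma_aa_Sigma_block_word (m : nat) (X : {set 'I_m.+1}) (i : 'I_m.+1) :
  Sigma_aa_Sigma (block_word X i) <-> i \in X.
Proof.
rewrite Sigma_aa_SigmaP; split=> [[k [wk wk1]]|iX].
  have lt_k1 : k.+1 < 3 * m.+1.
    rewrite ltnNge; apply/negP => le_k; move: wk1.
    by rewrite nth_default // size_tuple.
  move: wk wk1; rewrite !nth_block_word //; last exact: ltnW.
  rewrite /block_letter !letter_of_bool_a.
  move=> /orP[/andP[/eqP k0 kX]|/andP[/eqP k1 _]]; last by lia.
  move=> /orP[/andP[/eqP k1 _]|/andP[_ /eqP ki]]; first by lia.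
  have ki' : k %/ 3 = i by lia.
  by move: kX; rewrite ki' inord_val.
exists (3 * i); have := ltn_ord i => lt_i.
rewrite !nth_block_word; try lia.
rewrite /block_letter !letter_of_bool_a modnMr mulKn // inord_val iX.
by split=> //; apply/orP; right; apply/andP; split; apply/eqP; lia.
Qed.

Lemma card_state_Sigma_aa_Sigma (A : algorithm letter) (m : nat) :
  solves_out_of_order Sigma_aa_Sigma A ->
  2 ^ m.+1 <= #|state (A (3 * m.+1))|.
Proof.
move=> A_L; have <- : #|{set 'I_m.+1}| = 2 ^ m.+1.
  by rewrite -cardsT -powersetT card_powerset cardsT card_ord.
apply: (@card_state_ge _ _ _ Sigma_aa_Sigma (fun p : 'I_ _ => p %% 3 == 0) _ _
  ord0 (@block_word m)).
- by move=> v pi; apply: A_L.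
- move=> X i i' p /eqP p0; rewrite !tnth_mktuple /block_letter p0 /=.
  by rewrite !orbF.
- by move=> X X' i p /negPf p0; rewrite !tnth_mktuple /block_letter p0.
(* The second part with its [a] in block [i] queries whether [i] is in the set, so the answers for
   all [i] recover the set. *)
- move=> X X' XX'; apply/setP => i.
  by apply/idP/idP => /Sigma_aa_Sigma_block_word/XX'/Sigma_aa_Sigma_block_word.
Qed.

Local Open Scope ring_scope.

Lemma le_exponent_of_powR (R : realType) (m c : nat) (x : R) :
  (2 ^ m <= c)%N -> c%:R <= 2 `^ x -> m%:R <= x.
Proof.
move=> le_mc le_cx.
have: (2 : R) `^ m%:R <= 2 `^ x.
  by rewrite powR_mulrn // (le_trans _ le_cx) // -natrX ler_nat.
(* Real powers of 2 are exponentials of multiples of [ln 2], and this positive factor cancels. *)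
rewrite /powR pnatr_eq0 /= ler_expR ler_pM2r // ln_gt0 //.
by rewrite ltr1n.
Qed.

(** The limit superior is an infimum of suprema over neighbourhoods of infinity, each of which
    contains a tail and hence an index where [u] is at least [c]. *)
Lemma limn_esup_ge_frequently (R : realType) (u : nat -> \bar R) (c : \bar R) :
  (forall N, exists2 n, (N <= n)%N & (c <= u n)%E) -> (c <= limn_esup u)%E.
Proof.
move=> u_ge; apply: le_ereal_inf_tmp => _ [V [N _ NV] <-].
have [n le_Nn le_cn] := u_ge N.
by apply: (le_trans le_cn); apply: ereal_sup_ubound; exists n => //; apply: NV.
Qed.

Theorem proposition2p3 (R : realType) :
  out_of_order_space_Omega Sigma_aa_Sigma (fun n : nat => (n%:R : R)%R).
Proof.
(* At lengths [n = 3 * N.+1] the state count forces [s n] to be at least [N.+1], a third of [n]. *)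
move=> A s A_L A_s; apply: (@lt_le_trans _ _ (3^-1)%:E).
  by rewrite lte_fin invr_gt0.
apply: limn_esup_ge_frequently => N; exists (3 * N.+1)%N; first by lia.
have := le_exponent_of_powR (card_state_Sigma_aa_Sigma N A_L) (A_s _ _).
move=> /(_ isT) le_s.
by rewrite lee_fin ler_pdivlMr ?ltr0n // natrM mulKf ?pnatr_eq0.
Qed.
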